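(* Let $X$ and $Y$ be sets, and let $\alpha$ be either an infinite cardinal or $0$. Then: (i) if $\aleph_0 \leq |X| < |Y|$ and $\alpha \in \{0, |Y|\}$, then every sequence of words (over a countable alphabet) that is universal for $I(X,\alpha)$ is also universal for $I(Y,\alpha)$; (ii) if $2^{\aleph_0} < |X| < |Y|$, $|X|$ is a regular cardinal, and either $\alpha < |X|$ or $\alpha \geq |Y|$, then every sequence of words (over a countable alphabet) that is universal for $I(Y,\alpha)$ is also universal for $I(X,\alpha)$.
   Context: For an alphabet $A$ (a finite or countable set), $A^+$ is the free semigroup of non-empty words over $A$. A sequence $w_1, w_2, \ldots \in A^+$ is universal for a semigroup $S$ if for every sequence $s_1, s_2, \ldots \in S$ there is a homomorphism $\phi: A^+ \to S$ with $(w_n)\phi = s_n$ for all $n \geq 1$. For a set $X$, $I(X)$ is the symmetric inverse monoid of all partial permutations of $X$ (bijections between subsets of $X$) under composition of binary relations. For $\alpha$ an infinite cardinal or $0$, $I(X,\alpha)$ is the inverse subsemigroup of $I(X)$ consisting of all partial permutations $f$ with $|X\setminus \operatorname{dom}(f)| \leq \alpha$ and $|X\setminus \operatorname{ran}(f)| \leq \alpha$. Thus $I(X,0)=\operatorname{Sym}(X)$ and $I(X,\alpha)=I(X)$ for $\alpha\ge |X|$. An infinite cardinal $\lambda$ is regular if it is not the union of fewer than $\lambda$ sets each of cardinality less than $\lambda$. *)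

(* Defs.v *)
From Stdlib Require Import List.
Import ListNotations.

Definition le_card (A B : Type) : Prop :=
  exists f : A -> B, forall a1 a2, f a1 = f a2 -> a1 = a2.
Definition lt_card (A B : Type) : Prop := le_card A B /\ ~ le_card B A.
Definition eq_card (A B : Type) : Prop :=
  exists (f : A -> B) (g : B -> A),
    (forall a, g (f a) = a) /\ (forall b, f (g b) = b).

(* A cardinal alpha (given as the cardinality of a type) is 0 or infinite *)
Definition zero_or_infinite (A : Type) : Prop := (A -> False) \/ le_card nat A.

Definition regular_card (X : Type) : Prop :=
  le_card nat X /\
  forall (I : Type) (S : I -> X -> Prop),
    lt_card I X ->
    (forall i, lt_card {x : X | S i x} X) ->
    ~ (forall x : X, exists i, S i x).

(* Binary relations on X (partial maps are relations). *)
Definition rel (X : Type) := X -> X -> Prop.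

Definition rcomp {X : Type} (f g : rel X) : rel X :=
  fun x z => exists y, f x y /\ g y z.

Definition rel_eq {X : Type} (f g : rel X) : Prop := forall x y, f x y <-> g x y.

Definition partial_perm {X : Type} (f : rel X) : Prop :=
  (forall x y1 y2, f x y1 -> f x y2 -> y1 = y2) /\
  (forall x1 x2 y, f x1 y -> f x2 y -> x1 = x2).

Definition dom_compl {X : Type} (f : rel X) : Type := {x : X | ~ exists y, f x y}.
Definition ran_compl {X : Type} (f : rel X) : Type := {y : X | ~ exists x, f x y}.

(* membership in I(X, alpha), alpha = |A| *)
Definition in_I (X A : Type) (f : rel X) : Prop :=
  partial_perm f /\ le_card (dom_compl f) A /\ le_card (ran_compl f) A.

Definition countable (S : Type) : Prop := le_card S nat.

(* non-empty words over Sig: first letter and the rest *)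
Definition word (Sig : Type) := (Sig * list Sig)%type.

(* image of a word under the homomorphism A^+ -> I(X,alpha) extending phi *)
Definition eval_word {X Sig : Type} (phi : Sig -> rel X) (w : word Sig) : rel X :=
  fold_left (fun r a => rcomp r (phi a)) (snd w) (phi (fst w)).

(* w is universal for I(X, alpha): every sequence in I(X,alpha) is the image of w
   under some homomorphism A^+ -> I(X,alpha) (determined by images of letters) *)
Definition universal_I {Sig : Type} (X A : Type) (w : nat -> word Sig) : Prop :=
  forall s : nat -> rel X, (forall n, in_I X A (s n)) ->
    exists phi : Sig -> rel X, (forall a, in_I X A (phi a)) /\
      forall n, rel_eq (eval_word phi (w n)) (s n).

(* Main.v *)
(* Orbits of the inverse semigroup generated by the given sequence [s] are countable.

   (i) Group the orbits of [s] on [Y] into invariant blocks of size [|X|], solve on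
   each block by universality for [X], and glue.

   (ii) There are at most [2^aleph_0] isomorphism types of pointed orbits, so by
   regularity some orbit occurs [|X|] times in [X].  Adding [|Y|] further copies of it
   extends [s] to a sequence on a set of size [|Y|]: this stays in [I(Y, alpha)],
   since for [alpha < |X|] the repeated orbit has no deficiency.  Solve there by some
   [phi] and restrict to a [phi]-invariant subset of size [|X|] that contains the rest
   of [X] and [|X|] copies of the repeated orbit; it is isomorphic to [(X, s)]. *)

From mathcomp Require classical_sets.
From Stdlib Require Import Classical ClassicalEpsilon.
From Stdlib Require Import FunctionalExtensionality PropExtensionality.
From Stdlib Require Import Cantor List.
Import ListNotations.
Require Import Defs.

(** * Injections between types *)

Lemma choice (A B : Type) (R : A -> B -> Prop) :
  (forall a, exists b, R a b) -> exists f : A -> B, forall a, R a (f a).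
Proof.
  intros H.
  exists (fun a => proj1_sig (constructive_indefinite_description _ (H a))).
  intros a. apply proj2_sig.
Qed.

Lemma le_card_refl (A : Type) : le_card A A.
Proof. exists (fun a => a). auto. Qed.

Lemma le_card_trans (A B C : Type) : le_card A B -> le_card B C -> le_card A C.
Proof. intros [f Hf] [g Hg]. exists (fun a => g (f a)). auto. Qed.

(** Lets an injection be described by a relation, with values picked by choice. The relation may be
    multivalued; only its injectivity matters. *)
Lemma le_card_rel (A B : Type) (R : A -> B -> Prop) :
  (forall a, exists b, R a b) ->
  (forall a1 a2 b, R a1 b -> R a2 b -> a1 = a2) -> le_card A B.
Proof.
  intros Htot Hinj. destruct (choice _ _ _ Htot) as [f Hf].
  exists f. intros a1 a2 E. apply (Hinj a1 a2 (f a1)); [auto | rewrite E; auto].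
Qed.

Lemma sig_eq (A : Type) (P : A -> Prop) (x y : {a | P a}) :
  proj1_sig x = proj1_sig y -> x = y.
Proof. apply eq_sig_hprop. intros a p q. apply proof_irrelevance. Qed.

Lemma le_card_sig (A : Type) (P : A -> Prop) : le_card {a | P a} A.
Proof. exists (@proj1_sig _ _). intros x y. apply sig_eq. Qed.

Lemma le_card_prod (A A' B B' : Type) :
  le_card A A' -> le_card B B' -> le_card (A * B) (A' * B').
Proof.
  intros [f Hf] [g Hg]. exists (fun p => (f (fst p), g (snd p))).
  intros [a b] [a' b'] E. simpl in E. injection E as E1 E2.
  apply Hf in E1. apply Hg in E2. congruence.
Qed.

Lemma le_card_nat_prod_nat : le_card (nat * nat) nat.
Proof.
  exists to_nat. intros p q E.
  rewrite <- (cancel_of_to p), <- (cancel_of_to q). now rewrite E.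
Qed.

Lemma le_card_list_nat : le_card (list nat) nat.
Proof.
  destruct le_card_nat_prod_nat as [c Hc].
  (* The successor keeps the codes of non-empty lists apart from the code 0 of the empty one. *)
  exists (fix code l := match l with [] => 0 | n :: l' => S (c (n, code l')) end).
  induction a1 as [|n l IH]; intros [|n' l'] E; try discriminate; auto.
  injection E as E. apply Hc in E. injection E as -> E. f_equal. auto.
Qed.

Lemma le_card_list (A B : Type) : le_card A B -> le_card (list A) (list B).
Proof.
  intros [f Hf]. exists (map f).
  induction a1 as [|a l IH]; intros [|a' l'] E; try discriminate; auto.
  injection E as E1 E2. apply Hf in E1. apply IH in E2. congruence.
Qed.

Lemma le_card_signed_words (K : Type) : le_card K nat -> le_card (list (K * bool)) nat.
Proof.
  intros HK. eapply le_card_trans; [|apply le_card_list_nat]. apply le_card_list.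
  eapply le_card_trans; [|apply le_card_nat_prod_nat].
  apply le_card_prod; auto.
  exists (fun b : bool => if b then 1 else 0). intros [] []; discriminate || auto.
Qed.

Lemma cantor_bernstein (A B : Type) : le_card A B -> le_card B A -> eq_card A B.
Proof.
  intros [f Hf] [g Hg].
  (* [N] consists of the points whose backward chain along [g] and [f] stops outside the range of
     [g]. The bijection [R] follows [f] on [N] and the inverse of [g] elsewhere. *)
  pose (N := fun a => exists n a0, (forall b, g b <> a0) /\
                                   a = Nat.iter n (fun x => g (f x)) a0).
  assert (Nstep : forall a, N a -> N (g (f a))).
  { intros a (n & a0 & H & ->). exists (S n), a0. auto. }
  assert (Nback : forall a, N (g (f a)) -> N a).
  { intros a ([|n] & a0 & H & E).
    - simpl in E. elim (H (f a)). auto.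
    - exists n, a0. split; auto. }
  assert (Ng : forall a, ~ N a -> exists b, g b = a).
  { intros a Ha. apply NNPP. intros H. apply Ha. exists 0, a. split; auto.
    intros b E. apply H. eauto. }
  pose (R := fun a b => (N a /\ b = f a) \/ (~ N a /\ a = g b)).
  assert (Rtot : forall a, exists b, R a b).
  { intros a. destruct (classic (N a)) as [H|H].
    - exists (f a). left. auto.
    - destruct (Ng a H) as [b E]. exists b. right. auto. }
  assert (Rsur : forall b, exists a, R a b).
  { intros b. destruct (classic (N (g b))) as [H|H].
    - destruct H as ([|n] & a0 & H & E).
      + elim (H b). auto.
      + exists (Nat.iter n (fun x => g (f x)) a0). left. split.
        * exists n, a0. auto.
        * apply Hg. auto.
    - exists (g b). right. auto. }
  assert (Rfun : forall a b1 b2, R a b1 -> R a b2 -> b1 = b2).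
  { intros a b1 b2 [[H1 E1]|[H1 E1]] [[H2 E2]|[H2 E2]]; try tauto; try congruence.
    apply Hg. congruence. }
  assert (Rinj : forall a1 a2 b, R a1 b -> R a2 b -> a1 = a2).
  { intros a1 a2 b [[H1 E1]|[H1 E1]] [[H2 E2]|[H2 E2]]; subst; auto.
    - elim H2. auto.
    - elim H1. auto. }
  destruct (choice _ _ _ Rtot) as [h Hh]. destruct (choice _ _ _ Rsur) as [k Hk].
  exists h, k. split; intros x; eauto.
Qed.

(** * Zorn's lemma, comparability of cardinals, absorption of a countable factor *)

(** The chain [F] may be empty, so the hypothesis also covers the empty set and non-emptiness needs
    no separate argument. *)
Lemma zorn_union (T : Type) (P : (T -> Prop) -> Prop) :
  (forall F : (T -> Prop) -> Prop, (forall B, F B -> P B) ->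
     (forall B B', F B -> F B' -> (forall x, B x -> B' x) \/ (forall x, B' x -> B x)) ->
     P (fun x => exists B, F B /\ B x)) ->
  exists M, P M /\ forall B, P B -> (forall x, M x -> B x) -> forall x, B x -> M x.
Proof.
  intros Hchain. destruct (classical_sets.Zorn_bigcup (T := T) (P := P)) as (M & HM & Hmax).
  - intros F HF Htot.
    replace (classical_sets.bigcup F (fun X => X)) with (fun x => exists B, F B /\ B x).
    + apply Hchain; auto.
    + apply functional_extensionality. intros x. apply propositional_extensionality.
      split; [intros (B & ? & ?); exists B; auto | intros [B ? ?]; eauto].
  - exists M. split; auto. intros B HB Hsub. apply NNPP. intros Hn.
    apply (Hmax B); auto. split; auto.
Qed.

Lemma le_card_total (A B : Type) : le_card A B \/ le_card B A.
Proof.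
  pose (inj := fun G : A * B -> Prop => forall a b a' b',
          G (a, b) -> G (a', b') -> (a = a' <-> b = b')).
  destruct (zorn_union _ inj) as (M & HM & Hmax).
  - intros F HF Hc a b a' b' (G & FG & HG) (G' & FG' & HG').
    destruct (Hc _ _ FG FG') as [H|H].
    + apply (HF G'); auto.
    + apply (HF G); auto.
  - destruct (classic (forall a, exists b, M (a, b))) as [H|H].
    { left. apply (le_card_rel A B (fun a b => M (a, b))); auto.
      intros a1 a2 b H1 H2. eapply HM; eauto. }
    destruct (classic (forall b, exists a, M (a, b))) as [H'|H'].
    { right. apply (le_card_rel B A (fun b a => M (a, b))); auto.
      intros b1 b2 a H1 H2. eapply HM; eauto. }
    apply not_all_ex_not in H. destruct H as [a Ha].
    apply not_all_ex_not in H'. destruct H' as [b Hb].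
    elim Ha. exists b.
    apply (Hmax (fun p => M p \/ p = (a, b))); auto.
    intros a1 b1 a2 b2 [H1|H1] [H2|H2].
    + apply HM; auto.
    + injection H2 as -> ->. split; intros ->; [elim Ha | elim Hb]; eauto.
    + injection H1 as -> ->. split; intros <-; [elim Ha | elim Hb]; eauto.
    + injection H1 as -> ->. injection H2 as -> ->. tauto.
Qed.

(** For a maximal such graph, the complement of [S] contains no copy of [nat], so it is countable.
    Hence [A] embeds into [S * nat], and so into [S], and then [A * nat] embeds into [S * nat] and
    into [S]. *)
Lemma le_card_prod_nat (A : Type) : le_card nat A -> le_card (A * nat) A.
Proof.
  intros HA.
  (* [G] is the graph of an injection [S * nat -> S] for some [S : A -> Prop]. *)
  pose (P := fun G : (A * nat) * A -> Prop =>
    (forall s n a s' n' a', G ((s, n), a) -> G ((s', n'), a') ->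
        ((s, n) = (s', n') <-> a = a')) /\
    (forall s n a, G ((s, n), a) -> forall m, exists b, G ((s, m), b)) /\
    (forall s n a, G ((s, n), a) -> exists b, G ((a, 0), b))).
  destruct (zorn_union _ P) as (M & (Minj & Mdom & Mran) & Hmax).
  - intros F HF Hc. split; [|split].
    + intros s n a s' n' a' (G & FG & HG) (G' & FG' & HG').
      destruct (Hc _ _ FG FG') as [H|H].
      * apply (HF G'); auto.
      * apply (HF G); auto.
    + intros s n a (G & FG & HG) m. destruct (HF G FG) as (_ & H & _).
      destruct (H _ _ _ HG m) as [b Hb]. eauto.
    + intros s n a (G & FG & HG). destruct (HF G FG) as (_ & _ & H).
      destruct (H _ _ _ HG) as [b Hb]. eauto.
  - pose (S := fun s => exists a, M ((s, 0), a)).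
    assert (HS : le_card ({s | S s} * nat) {s | S s}).
    { apply (le_card_rel _ _ (fun p t => M ((proj1_sig (fst p), snd p), proj1_sig t))).
      - intros [[s [a Hs]] n]. simpl. destruct (Mdom _ _ _ Hs n) as [b Hb].
        exists (exist S b (Mran _ _ _ Hb)). auto.
      - intros [s n] [s' n'] t H1 H2. simpl in *.
        destruct (Minj _ _ _ _ _ _ H1 H2) as [_ E]. specialize (E eq_refl).
        injection E as E ->. f_equal. apply sig_eq. auto. }
    assert (Hout : ~ le_card nat {s | ~ S s}).
    { intros [u Hu].
      assert (HuS : forall i a b n, ~ M ((proj1_sig (u i), n), a) /\ ~ M (b, proj1_sig (u i))).
      { intros i a [b m] n. destruct (u i) as [x Hx]. simpl. split; intros H; apply Hx.
        - destruct (Mdom _ _ _ H 0). red; eauto.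
        - destruct (Mran _ _ _ H). red; eauto. }
      assert (Hu' : forall i j, proj1_sig (u i) = proj1_sig (u j) -> i = j).
      { intros i j E. apply Hu, sig_eq, E. }
      destruct le_card_nat_prod_nat as [c Hc].
      (* The range of [u] carries its own injection, copied from [c]. It is disjoint from [M], so it
         could be added. *)
      pose (N := fun p => exists i n, p = ((proj1_sig (u i), n), proj1_sig (u (c (i, n))))).
      assert (HN : N ((proj1_sig (u 0), 0), proj1_sig (u (c (0, 0))))).
      { exists 0, 0. auto. }
      apply (proj1 (HuS 0 (proj1_sig (u (c (0, 0)))) (proj1_sig (u 0), 0) 0)).
      apply (Hmax (fun p => M p \/ N p)); [|auto|auto].
      split; [|split].
      - intros s n a s' n' a' [H|(i & j & H)] [H'|(i' & j' & H')].
        + apply Minj; auto.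
        + injection H' as -> -> ->. split.
          * intros E. injection E as -> ->. elim (proj1 (HuS i' a (a, 0) j')). auto.
          * intros ->. elim (proj2 (HuS (c (i', j')) s (s, n) 0)). auto.
        + injection H as -> -> ->. split.
          * intros E. injection E as <- <-. elim (proj1 (HuS i a' (a', 0) j)). auto.
          * intros <-. elim (proj2 (HuS (c (i, j)) s' (s', n') 0)). auto.
        + injection H as -> -> ->. injection H' as -> -> ->. split; intros E.
          * injection E as E ->. apply Hu' in E. subst. auto.
          * apply Hu', Hc in E. congruence.
      - intros s n a [H|(i & j & H)] m.
        + destruct (Mdom _ _ _ H m). eauto.
        + injection H as -> -> ->. eexists. right. exists i, m. reflexivity.
      - intros s n a [H|(i & j & H)].
        + destruct (Mran _ _ _ H). eauto.
        + injection H as -> -> ->. eexists. right. eexists _, 0. reflexivity. }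
    assert (Hout' : le_card {s | ~ S s} nat).
    { destruct (le_card_total nat {s | ~ S s}); tauto. }
    assert (Hs0 : exists s0, S s0).
    { apply NNPP. intros H. apply Hout. eapply le_card_trans; [exact HA|].
      apply (le_card_rel _ _ (fun a b => a = proj1_sig b)).
      - intros a. assert (Ha : ~ S a) by eauto. exists (exist _ a Ha). auto.
      - intros; congruence. }
    destruct Hs0 as [s0 Hs0]. destruct Hout' as [o Ho].
    (* Index 0 is kept for the points of [S]; the countable complement is listed over the single
       point [s0] at positive indices. *)
    assert (HAS : le_card A ({s | S s} * nat)).
    { apply (le_card_rel _ _ (fun a p =>
        (a = proj1_sig (fst p) /\ snd p = 0) \/
        (exists Ha : ~ S a, fst p = exist _ s0 Hs0 /\ snd p = Datatypes.S (o (exist _ a Ha))))).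
      - intros a. destruct (classic (S a)) as [Ha|Ha].
        + exists (exist _ a Ha, 0). auto.
        + exists (exist _ s0 Hs0, Datatypes.S (o (exist _ a Ha))). right. exists Ha. auto.
      - intros a1 a2 [p n] [[H1 E1]|(H1 & _ & E1)] [[H2 E2]|(H2 & _ & E2)];
          simpl in *; try congruence.
        rewrite E1 in E2. injection E2 as E2. apply Ho in E2. injection E2. auto. }
    assert (HAS' : le_card A {s | S s}) by (eapply le_card_trans; eauto).
    eapply le_card_trans; [|apply le_card_sig].
    eapply le_card_trans; [|exact HS].
    apply le_card_prod; [exact HAS' | apply le_card_refl].
Qed.

Lemma le_card_sum (A B C : Type) :
  le_card nat C -> le_card A C -> le_card B C -> le_card (A + B) C.
Proof.
  intros HC [f Hf] [g Hg]. eapply le_card_trans; [|apply (le_card_prod_nat C HC)].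
  exists (fun s => match s with inl a => (f a, 0) | inr b => (g b, 1) end).
  intros [a|b] [a'|b'] E; injection E; try discriminate; intros; f_equal; auto.
Qed.

(** Used to count orbits: an uncountable set cut into countable orbits has at least as many orbits
    as points. A countable [Q] would make [A] countable, so [Q] is infinite and absorbs the
    factor. *)
Lemma le_card_of_prod_nat (A Q : Type) :
  ~ le_card A nat -> le_card A (Q * nat) -> le_card A Q.
Proof.
  intros HA HQ. destruct (le_card_total nat Q) as [H|H].
  - eapply le_card_trans; [exact HQ | apply le_card_prod_nat; auto].
  - elim HA. eapply le_card_trans; [exact HQ|].
    eapply le_card_trans; [|apply le_card_nat_prod_nat].
    apply le_card_prod; auto using le_card_refl.
Qed.

(* Take a maximal disjoint family of subsets of size [|X|]; what it misses has
   size at most [|X|] and is absorbed by one member of the family. *)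
Lemma equipotent_fibers (X Q : Type) :
  le_card nat X -> le_card X Q ->
  exists c : Q -> (Q -> Prop), forall q, eq_card X {q' | c q' = c q}.
Proof.
  intros HX HXQ.
  pose (P := fun F : (Q -> Prop) -> Prop =>
    (forall B, F B -> eq_card X {q | B q}) /\
    (forall B B' q, F B -> F B' -> B q -> B' q -> B = B')).
  destruct (zorn_union _ P) as (M & (Msize & Mdisj) & Hmax).
  - intros Ch HCh Hc. split.
    + intros B (F & HF & FB). apply (HCh F HF). auto.
    + intros B B' q (F & HF & FB) (F' & HF' & FB').
      destruct (Hc _ _ HF HF') as [H|H].
      * apply (HCh F' HF'); auto.
      * apply (HCh F HF); auto.
  - pose (L := fun q => forall B, M B -> ~ B q).
    assert (HL : ~ le_card X {q | L q}).
    { intros [f Hf].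
      pose (B0 := fun q => exists x, q = proj1_sig (f x)).
      assert (HB0 : M B0).
      { apply (Hmax (fun B => M B \/ B = B0)); auto. split.
        - intros B [HB| ->]; [auto|]. apply cantor_bernstein.
          + exists (fun x => exist B0 (proj1_sig (f x)) (ex_intro _ x eq_refl)).
            intros x y E. injection E as E. apply Hf, sig_eq, E.
          + apply (le_card_rel _ _ (fun b x => proj1_sig b = proj1_sig (f x))).
            * intros [b [x Hx]]. eauto.
            * intros. apply sig_eq. congruence.
        - intros B B' q [HB| ->] [HB'| ->] Hq Hq'; auto.
          + eauto.
          + destruct Hq' as [x ->]. elim (proj2_sig (f x) B); auto.
          + destruct Hq as [x ->]. elim (proj2_sig (f x) B'); auto. }
      destruct HX as [i _]. elim (proj2_sig (f (i 0)) B0 HB0). exists (i 0). auto. }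
    assert (HB0 : exists B0, M B0).
    { apply NNPP. intros H. apply HL. destruct HXQ as [f Hf].
      assert (HLf : forall x, L (f x)) by (intros x B HB; elim H; eauto).
      exists (fun x => exist L (f x) (HLf x)). intros x y E. injection E. auto. }
    (* Each point is labelled by the member of the family containing it, and the leftovers in [L] by
       [B0]. *)
    destruct HB0 as [B0 HB0].
    assert (Hc : forall q, exists B, M B /\ (B q \/ (L q /\ B = B0))).
    { intros q. destruct (classic (exists B, M B /\ B q)) as [(B & HB & Hq)|H].
      - eauto.
      - exists B0. split; auto. right. split; auto. intros B HB Hq. eauto. }
    destruct (choice _ _ _ Hc) as [c Hc']. exists c. intros q.
    destruct (Hc' q) as [HM _]. set (B := c q) in *.
    destruct (Msize B HM) as (f & g & Hgf & Hfg).
    apply cantor_bernstein.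
    + assert (HcB : forall x, c (proj1_sig (f x)) = B).
      { intros x. destruct (Hc' (proj1_sig (f x))) as [H1 [H2|[H2 _]]].
        - eapply Mdisj; eauto. apply (proj2_sig (f x)).
        - elim (H2 B HM). apply (proj2_sig (f x)). }
      exists (fun x => exist (fun q' => c q' = B) _ (HcB x)).
      intros x y E. injection E as E. apply sig_eq in E.
      rewrite <- (Hgf x), <- (Hgf y). congruence.
    + apply (le_card_trans _ ({q | B q} + {q | L q})).
      * apply (le_card_rel _ _ (fun q' s => match s with
            inl b => proj1_sig q' = proj1_sig b | inr l => proj1_sig q' = proj1_sig l end)).
        -- intros [q' Hq']. simpl. destruct (Hc' q') as [_ [H|[H _]]].
           ++ rewrite Hq' in H. exists (inl (exist _ q' H)). auto.
           ++ exists (inr (exist _ q' H)). auto.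
        -- intros q1 q2 [b|l] H1 H2; apply sig_eq; congruence.
      * apply le_card_sum; auto.
        -- exists g. intros x y E. rewrite <- (Hfg x), <- (Hfg y). congruence.
        -- destruct (le_card_total X {q | L q}); tauto.
Qed.

(** * Partial permutations and restriction to invariant subsets *)

Lemma rel_ext (X : Type) (f g : rel X) : rel_eq f g -> f = g.
Proof.
  intros H. apply functional_extensionality. intros x.
  apply functional_extensionality. intros y. apply propositional_extensionality, H.
Qed.

(** The flag selects [f] or its inverse, so that functionality and injectivity, or domain and range,
    become one statement quantified over [b]. *)
Definition step {X : Type} (f : rel X) (b : bool) : rel X :=
  fun x y => if b then f x y else f y x.

Lemma in_I_step (X A : Type) (f : rel X) :
  in_I X A f <->
  (forall b x y z, step f b x y -> step f b x z -> y = z) /\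
  (forall b, le_card {x | ~ exists y, step f b x y} A).
Proof.
  split.
  - intros [[Hf Hi] [Hd Hr]]. split; intros [].
    + exact Hf.
    + intros x y z. apply Hi.
    + exact Hd.
    + exact Hr.
  - intros [Hf Hc]. split; [split|split].
    + intros x y z. apply (Hf true).
    + intros x y z. apply (Hf false).
    + apply (Hc true).
    + apply (Hc false).
Qed.

Definition pull {X Z : Type} (h : X -> Z) (f : rel Z) : rel X :=
  fun x y => f (h x) (h y).

Definition invariant {X : Type} (C : X -> Prop) (f : rel X) : Prop :=
  forall x y, f x y -> (C x <-> C y).

Definition image {X Z : Type} (h : X -> Z) : Z -> Prop := fun z => exists x, z = h x.

(** Invariance prevents new deficiencies: if [f] is defined at [h x], its value stays in the image
    of [h]. So the missing points of the restriction inject into those of [f]. *)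
Lemma in_I_pull (X Z A : Type) (h : X -> Z) (f : rel Z) :
  (forall x y, h x = h y -> x = y) -> invariant (image h) f ->
  in_I Z A f -> in_I X A (pull h f).
Proof.
  intros Hh Hinv Hf. apply in_I_step in Hf. destruct Hf as [Hf Hc].
  assert (E : forall b x y, step (pull h f) b x y = step f b (h x) (h y)).
  { intros []; reflexivity. }
  apply in_I_step. split.
  - intros b x y z. rewrite !E. intros H1 H2. apply Hh. eauto.
  - intros b. eapply le_card_trans; [|apply (Hc b)].
    apply (le_card_rel _ _ (fun x z => proj1_sig z = h (proj1_sig x))).
    + intros [x Hx]. simpl.
      assert (Hhx : ~ exists z, step f b (h x) z).
      { intros [z Hz]. apply Hx.
        assert (Hi : image h z).
        { destruct b; apply Hinv in Hz; apply Hz; exists x; auto. }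
        destruct Hi as [y ->]. exists y. rewrite E. auto. }
      exists (exist _ (h x) Hhx). auto.
    + intros x y z H1 H2. apply sig_eq, Hh. congruence.
Qed.

Lemma eval_word_invariant (X Sig : Type) (C : X -> Prop) (phi : Sig -> rel X) (w : word Sig) :
  (forall a, invariant C (phi a)) -> invariant C (eval_word phi w).
Proof.
  intros H. destruct w as [a l]. unfold eval_word. simpl.
  generalize (phi a) (H a). induction l as [|b l IH]; simpl; auto.
  intros f Hf. apply IH. intros x z (y & H1 & H2).
  apply Hf in H1. apply H in H2. tauto.
Qed.

(** By invariance, the intermediate points of a composition that starts in the image of [h] also lie
    in that image. *)
Lemma eval_word_pull (X Z Sig : Type) (h : X -> Z) (phi : Sig -> rel Z) (w : word Sig) :
  (forall a, invariant (image h) (phi a)) ->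
  eval_word (fun a => pull h (phi a)) w = pull h (eval_word phi w).
Proof.
  intros H. destruct w as [a l]. unfold eval_word. simpl.
  generalize (phi a) (H a). induction l as [|b l IH]; simpl; auto.
  intros f Hf.
  replace (rcomp (pull h f) (pull h (phi b))) with (pull h (rcomp f (phi b))).
  - apply IH. intros x z (y & H1 & H2). apply Hf in H1. apply H in H2. tauto.
  - apply rel_ext. intros x z. split.
    + intros (y & H1 & H2). assert (Hy : image h y).
      { apply Hf in H1. apply H1. exists x. auto. }
      destruct Hy as [y' ->]. exists y'. auto.
    + intros (y & H1 & H2). exists (h y). auto.
Qed.

Lemma universal_I_eq_card (X Y A Sig : Type) (w : nat -> word Sig) :
  eq_card X Y -> universal_I X A w -> universal_I Y A w.
Proof.
  intros (f & g & Hgf & Hfg) HX s Hs.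
  destruct (HX (fun n => pull f (s n))) as (phi & Hphi & Hev).
  - intros n. apply in_I_pull; auto.
    + intros x y E. rewrite <- (Hgf x), <- (Hgf y). congruence.
    + intros x y _. split; intros _; eexists; symmetry; apply Hfg.
  - assert (Hinv : forall a, invariant (image g) (phi a)).
    { intros a x y _. split; intros _; eexists; symmetry; apply Hgf. }
    exists (fun a => pull g (phi a)). split.
    + intros a. apply in_I_pull; auto.
      intros x y E. rewrite <- (Hfg x), <- (Hfg y). congruence.
    + intros n. rewrite eval_word_pull; auto. intros x y.
      unfold pull at 1. rewrite (Hev n (g x) (g y)). unfold pull. rewrite !Hfg. tauto.
Qed.

(** * Orbits of a family of partial permutations *)

(** A signed word stands for a product of the [s k] and their inverses, the empty word for the
    identity. Thus [conn] below is the orbit relation. *)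
Fixpoint reach {K X : Type} (s : K -> rel X) (u : list (K * bool)) : rel X :=
  match u with
  | [] => eq
  | (k, b) :: u' => rcomp (step (s k) b) (reach s u')
  end.

Definition conn {K X : Type} (s : K -> rel X) : rel X :=
  fun x y => exists u, reach s u x y.

Lemma reach_app (K X : Type) (s : K -> rel X) (u v : list (K * bool)) (x z : X) :
  reach s (u ++ v) x z <-> exists y, reach s u x y /\ reach s v y z.
Proof.
  revert x. induction u as [|[k b] u IH]; intros x; simpl.
  - split; [eauto | intros (y & -> & H); auto].
  - split.
    + intros (y & H1 & H2). apply IH in H2. destruct H2 as (y' & H2 & H3).
      exists y'. split; auto. exists y. auto.
    + intros (y' & (y & H1 & H2) & H3). exists y. split; auto. apply IH. eauto.
Qed.

Lemma conn_refl (K X : Type) (s : K -> rel X) (x : X) : conn s x x.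
Proof. exists []. reflexivity. Qed.

Lemma conn_trans (K X : Type) (s : K -> rel X) (x y z : X) :
  conn s x y -> conn s y z -> conn s x z.
Proof. intros [u Hu] [v Hv]. exists (u ++ v). apply reach_app. eauto. Qed.

Lemma conn_step (K X : Type) (s : K -> rel X) (k : K) (b : bool) (x y : X) :
  step (s k) b x y -> conn s x y.
Proof. intros H. exists [(k, b)]. exists y. split; [auto | reflexivity]. Qed.

Lemma conn_sym (K X : Type) (s : K -> rel X) (x y : X) : conn s x y -> conn s y x.
Proof.
  intros [u Hu]. revert x Hu. induction u as [|[k b] u IH]; intros x; simpl.
  - intros ->. apply conn_refl.
  - intros (z & H1 & H2). eapply conn_trans; [apply IH; eauto|].
    apply (conn_step _ _ s k (negb b)). destruct b; exact H1.
Qed.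

Lemma invariant_conn (K X : Type) (s : K -> rel X) (x : X) (k : K) :
  invariant (conn s x) (s k).
Proof.
  intros y z H.
  assert (H' : conn s y z) by (apply (conn_step _ _ s k true); exact H).
  split; intros Hx; eapply conn_trans; eauto. apply conn_sym. auto.
Qed.

Lemma reach_fun (K X : Type) (s : K -> rel X) (u : list (K * bool)) (x y z : X) :
  (forall k b x y z, step (s k) b x y -> step (s k) b x z -> y = z) ->
  reach s u x y -> reach s u x z -> y = z.
Proof.
  intros Hs. revert x. induction u as [|[k b] u IH]; intros x; simpl.
  - congruence.
  - intros (x1 & H1 & H2) (x2 & H3 & H4). rewrite (Hs _ _ _ _ _ H3 H1) in H4. eauto.
Qed.

Lemma reach_inj (K X : Type) (s : K -> rel X) (u : list (K * bool)) (x y z : X) :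
  (forall k b x y z, step (s k) b x y -> step (s k) b x z -> y = z) ->
  reach s u x z -> reach s u y z -> x = y.
Proof.
  intros Hs. revert x y. induction u as [|[k b] u IH]; intros x y; simpl.
  - congruence.
  - intros (x1 & H1 & H2) (x2 & H3 & H4). rewrite (IH _ _ H2 H4) in H1.
    apply (Hs k (negb b) x2); destruct b; auto.
Qed.

(** The representative is [epsilon] of a predicate depending only on the orbit, so connected points
    get the same one by extensionality. The predicate asks for a point of [D] whenever the orbit
    meets [D]. *)
Lemma orbit_representatives (K X : Type) (s : K -> rel X) (D : X -> Prop) :
  exists r : X -> X,
    (forall x, conn s (r x) x) /\
    (forall x y, conn s x y -> r x = r y) /\
    (forall d x, D d -> conn s d x -> D (r x)).
Proof.
  pose (R := fun x d => conn s d x /\ ((exists d', D d' /\ conn s d' x) -> D d)).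
  assert (HR : forall x, exists d, R x d).
  { intros x. destruct (classic (exists d', D d' /\ conn s d' x)) as [(d & H1 & H2)|H].
    - exists d. split; auto.
    - exists x. split; [apply conn_refl | tauto]. }
  exists (fun x => epsilon (inhabits x) (R x)).
  assert (Hspec : forall x, R x (epsilon (inhabits x) (R x))).
  { intros x. apply epsilon_spec, HR. }
  split; [|split].
  - intros x. apply Hspec.
  - intros x y Hxy. replace (R y) with (R x).
    + f_equal. apply proof_irrelevance.
    + apply functional_extensionality. intros d. apply propositional_extensionality.
      assert (H : forall d, conn s d x <-> conn s d y).
      { intros d'. split; intros H; eapply conn_trans; eauto. apply conn_sym. auto. }
      unfold R. rewrite (H d).
      assert (H' : (exists d', D d' /\ conn s d' x) <-> (exists d', D d' /\ conn s d' y)).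
      { split; intros (d' & H1 & H2); exists d'; split; auto; apply H; auto. }
      tauto.
  - intros d x Hd Hdx. apply Hspec. eauto.
Qed.

(** A point is determined by a starting point in [C] and a signed word leading from there to it, and
    there are countably many signed words. *)
Lemma le_card_orbits (K X : Type) (s : K -> rel X) (B : X -> Prop) (C : X -> Prop) :
  le_card K nat ->
  (forall k b x y z, step (s k) b x y -> step (s k) b x z -> y = z) ->
  (forall x, B x -> exists q, C q /\ conn s q x) ->
  le_card {x | B x} ({q | C q} * nat).
Proof.
  intros HK Hs HB. destruct (le_card_signed_words K HK) as [c Hc].
  apply (le_card_rel _ _ (fun x p => exists u, c u = snd p /\
    reach s u (proj1_sig (fst p)) (proj1_sig x))).
  - intros [x Hx]. destruct (HB x Hx) as (q & Hq & [u Hu]).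
    exists (exist _ q Hq, c u). exists u. auto.
  - intros x y p (u & E & Hu) (v & E' & Hv).
    rewrite <- E in E'. apply Hc in E'. subst v.
    apply sig_eq. eapply reach_fun; eauto.
Qed.

(** * From a set to a larger one *)

(** The fibres of [c] are invariant blocks, and the solutions on them are put side by side.
    Deficiencies add up over the blocks, which is harmless if there are none or if every size up to
    [|Y|] is allowed. *)
Lemma universal_I_glue (X Y A Sig : Type) (J : Type) (c : Y -> J)
    (w : nat -> word Sig) (s : nat -> rel Y) (y0 : Y) :
  (A -> False) \/ le_card Y A ->
  (forall n, in_I Y A (s n)) ->
  (forall n y z, s n y z -> c y = c z) ->
  (forall y, eq_card X {y' | c y' = c y}) ->
  universal_I X A w ->
  exists phi : Sig -> rel Y, (forall a, in_I Y A (phi a)) /\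
    forall n, rel_eq (eval_word phi (w n)) (s n).
Proof.
  intros HA Hs Hc Hsize HX.
  (* Chosen per label and not per point, so that all points of a block share one enumeration and one
     solution. For a label without points the claim is vacuous, and [y0] serves to build a dummy
     pair. *)
  assert (Hblock : forall P, exists p : (X -> Y) * (Sig -> rel X), forall y, c y = P ->
    (forall x1 x2, fst p x1 = fst p x2 -> x1 = x2) /\
    (forall z, c z = P <-> exists x, z = fst p x) /\
    (forall a, in_I X A (snd p a)) /\
    forall n, eval_word (snd p) (w n) = pull (fst p) (s n)).
  { intros P. destruct (classic (exists y, c y = P)) as [[y <-]|H].
    - destruct (Hsize y) as (f & g & Hgf & Hfg).
      pose (h := fun x => proj1_sig (f x)).
      assert (Hinj : forall x1 x2, h x1 = h x2 -> x1 = x2).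
      { intros x1 x2 E. apply sig_eq in E. rewrite <- (Hgf x1), <- (Hgf x2). congruence. }
      assert (Him : forall z, c z = c y <-> exists x, z = h x).
      { intros z. split.
        - intros Hz. exists (g (exist _ z Hz)). unfold h. rewrite Hfg. auto.
        - intros [x ->]. apply (proj2_sig (f x)). }
      destruct (HX (fun n => pull h (s n))) as (phi & Hphi & Hev).
      + intros n. apply in_I_pull; auto. intros u v Huv. apply Hc in Huv.
        unfold image. rewrite <- !Him, Huv. tauto.
      + exists (h, phi). intros _ _. split; [exact Hinj|split; [exact Him|split; [exact Hphi|]]].
        intros n. apply rel_ext, Hev.
    - exists (fun _ => y0, fun _ _ _ => False). intros y Hy. elim H. eauto. }
  destruct (choice _ _ _ Hblock) as [p Hp].
  assert (Hinj : forall y x1 x2, fst (p (c y)) x1 = fst (p (c y)) x2 -> x1 = x2).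
  { intros y. apply (Hp (c y) y eq_refl). }
  assert (Him : forall y z, c z = c y <-> exists x, z = fst (p (c y)) x).
  { intros y. apply (Hp (c y) y eq_refl). }
  pose (phi := fun a y z => exists x x', y = fst (p (c y)) x /\ z = fst (p (c y)) x' /\
                                         snd (p (c y)) a x x').
  assert (Hphic : forall a y z, phi a y z -> c y = c z).
  { intros a y z (x & x' & H1 & H2 & H3). symmetry. apply Him. eauto. }
  assert (Hphi_pull : forall y a, pull (fst (p (c y))) (phi a) = snd (p (c y)) a).
  { intros y a. apply rel_ext. intros x x'.
    assert (E : c (fst (p (c y)) x) = c y) by (apply Him; eauto).
    unfold pull, phi. rewrite E. split.
    - intros (x1 & x2 & H1 & H2 & H3). apply Hinj in H1. apply Hinj in H2. congruence.
    - intros H. exists x, x'. auto. }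
  assert (Hpt : forall y, exists x, y = fst (p (c y)) x).
  { intros y. apply Him. auto. }
  assert (Hstep_in : forall a b y z, step (phi a) b y z -> exists x x',
      y = fst (p (c y)) x /\ z = fst (p (c y)) x' /\ step (snd (p (c y)) a) b x x').
  { intros a b y z H. rewrite <- Hphi_pull.
    assert (E : c z = c y) by (destruct b; apply Hphic in H; auto).
    destruct (Hpt y) as [x Hx]. destruct (proj1 (Him y z) E) as [x' Hx'].
    exists x, x'. repeat split; auto.
    destruct b; simpl; unfold pull; rewrite <- Hx, <- Hx'; exact H. }
  exists phi. split.
  - intros a. apply in_I_step. split.
    + intros b y z1 z2 H1 H2.
      apply Hstep_in in H1. destruct H1 as (x & x1 & E1 & -> & H1).
      apply Hstep_in in H2. destruct H2 as (x' & x2 & E2 & -> & H2).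
      assert (x = x') by (apply (Hinj y); congruence). subst x'. f_equal.
      destruct (Hp (c y) y eq_refl) as (_ & _ & HI & _).
      specialize (HI a). apply in_I_step in HI. eapply HI; eauto.
    + intros b. destruct HA as [HA|HA].
      * enough (Hfull : forall y, exists z, step (phi a) b y z).
        { apply (le_card_rel _ _ (fun _ _ => True));
            [intros [y Hy] | intros [y Hy]]; elim (Hy (Hfull y)). }
        intros y. destruct (Hp (c y) y eq_refl) as (_ & _ & HI & _).
        specialize (HI a). apply in_I_step in HI. destruct HI as [_ HI].
        destruct (HI b) as [e _]. destruct (Hpt y) as [x Hx].
        apply NNPP. intros Hn.
        assert (Hx' : ~ exists z, step (snd (p (c y)) a) b x z).
        { intros [z Hz]. apply Hn. exists (fst (p (c y)) z).
          rewrite <- Hphi_pull in Hz. rewrite Hx at 1. destruct b; exact Hz. }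
        exact (HA (e (exist _ x Hx'))).
      * eapply le_card_trans; [apply le_card_sig | exact HA].
  - intros n y z.
    (* The two relations are compared inside a block; neither of them relates points of different
       blocks. *)
    assert (Hev : c z = c y -> (eval_word phi (w n) y z <-> s n y z)).
    { intros E. destruct (Hp (c y) y eq_refl) as (_ & _ & _ & Hn). specialize (Hn n).
      replace (snd (p (c y))) with (fun a => pull (fst (p (c y))) (phi a)) in Hn
        by (apply functional_extensionality; auto).
      rewrite eval_word_pull in Hn.
      - destruct (Hpt y) as [x Hx]. destruct (proj1 (Him y z) E) as [x' Hx'].
        apply (f_equal (fun f => f x x')) in Hn. unfold pull in Hn.
        rewrite <- Hx, <- Hx' in Hn. rewrite Hn. tauto.
      - intros a u v Huv. apply Hphic in Huv. unfold image. rewrite <- !Him, Huv. tauto. }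
    split; intros H; apply Hev; auto.
    + symmetry. cut (c y = c y <-> c z = c y); [intros HH; symmetry; apply HH; auto|].
      apply (eval_word_invariant _ _ (fun u => c u = c y) phi (w n)); auto.
      intros a u v Huv. apply Hphic in Huv. rewrite Huv. tauto.
    + symmetry. eauto.
Qed.

Lemma universal_I_larger (X Y A Sig : Type) (w : nat -> word Sig) :
  le_card nat X -> lt_card X Y -> ((A -> False) \/ le_card Y A) ->
  universal_I X A w -> universal_I Y A w.
Proof.
  intros HX [HXY HYX] HA Huniv s Hs.
  assert (Hfun : forall k b x y z, step (s k) b x y -> step (s k) b x z -> y = z).
  { intros k. apply (proj1 (proj1 (in_I_step _ _ _) (Hs k))). }
  destruct (orbit_representatives nat Y s (fun _ => True)) as (r & Hr & Hrc & _).
  assert (Hrr : forall y, r (r y) = r y) by auto.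
  pose (Q := {q | r q = q}).
  assert (Horb : forall B : Y -> Prop, le_card {y | B y}
            ({q | r q = q /\ exists y, B y /\ q = r y} * nat)).
  { intros B. apply (le_card_orbits _ _ s); auto using le_card_refl.
    intros y Hy. exists (r y). eauto. }
  (* [Q] indexes the countable orbits of the uncountable set [Y], so it has at least [|Y|]
     elements. *)
  assert (HQ : le_card X Q).
  { eapply le_card_trans; [exact HXY|]. apply le_card_of_prod_nat.
    - intros H. apply HYX. eapply le_card_trans; eauto.
    - apply (le_card_trans _ {y : Y | True}).
      + exists (fun y => exist _ y I). intros y y' E. injection E. auto.
      + eapply le_card_trans; [apply Horb|]. apply le_card_prod; [|apply le_card_refl].
        apply (le_card_rel _ _ (fun a b => proj1_sig a = proj1_sig b)).
        * intros [q [Hq Hq']]. exists (exist (fun q => r q = q) q Hq). auto.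
        * intros. apply sig_eq. congruence. }
  destruct (equipotent_fibers X Q HX HQ) as [c Hc].
  pose (rq := fun y => exist (fun q => r q = q) (r y) (Hrr y)).
  assert (Hrq : forall y y', r y = r y' -> rq y = rq y').
  { intros. apply sig_eq. auto. }
  assert (Hrq' : forall q : Q, rq (proj1_sig q) = q).
  { intros [q Hq]. apply sig_eq. auto. }
  destruct HX as [i Hi]. destruct HXY as [f Hf].
  assert (HX : le_card nat X) by (exists i; auto).
  apply (universal_I_glue X Y A Sig _ (fun y => c (rq y)) w s (f (i 0))); auto.
  - intros n y z H. f_equal. apply Hrq, Hrc. apply (conn_step _ _ s n true). exact H.
  (* A block consists of [|X|] orbits. Their representatives already give [|X|] points, and
     countability of orbits bounds the block by [|X|] times aleph_0. *)
  - intros y. destruct (Hc (rq y)) as (g & k & Hkg & Hgk). apply cantor_bernstein.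
    + apply (le_card_rel _ _ (fun x z => proj1_sig z = proj1_sig (proj1_sig (g x)))).
      * intros x.
        assert (H : c (rq (proj1_sig (proj1_sig (g x)))) = c (rq y)).
        { rewrite Hrq'. apply (proj2_sig (g x)). }
        exists (exist (fun z => c (rq z) = c (rq y)) _ H). reflexivity.
      * intros x1 x2 z H1 H2. rewrite <- (Hkg x1), <- (Hkg x2). f_equal.
        apply sig_eq, sig_eq. congruence.
    + eapply le_card_trans; [apply Horb|].
      eapply le_card_trans; [|apply le_card_prod_nat; exact HX].
      apply le_card_prod; [|apply le_card_refl].
      apply (le_card_rel _ _ (fun q x => proj1_sig q = proj1_sig (proj1_sig (g x)))).
      * intros (q & Hq & z & Hz & ->). simpl.
        exists (k (exist _ (rq z) Hz)). rewrite Hgk. reflexivity.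
      * intros. apply sig_eq. congruence.
Qed.

(** * Isomorphism types of pointed orbits *)

(* Two points with the same code have isomorphic orbits, see [partner]. *)
Definition code {K X : Type} (s : K -> rel X) (x : X) :
    list (K * bool) * list (K * bool) -> Prop :=
  fun p => exists z, reach s (fst p) x z /\ reach s (snd p) x z.

(** The candidate isomorphism between the orbits of [p] and [q]: follow the same signed word from
    both. Equality of codes makes it independent of the word. *)
Definition partner {K X : Type} (s : K -> rel X) (p q : X) : rel X :=
  fun x y => exists u, reach s u p x /\ reach s u q y.

Lemma partner_sym (K X : Type) (s : K -> rel X) (p q x y : X) :
  partner s p q x y -> partner s q p y x.
Proof. intros (u & H1 & H2). exists u. auto. Qed.

(** The diagonal pair [(u, u)] lies in the code exactly when [u] is defined at the point. *)
Lemma code_reach (K X : Type) (s : K -> rel X) (u : list (K * bool)) (p q x : X) :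
  code s p = code s q -> reach s u p x -> exists y, reach s u q y.
Proof.
  intros E H. assert (Hc : code s p (u, u)) by (exists x; auto).
  rewrite E in Hc. destruct Hc as (y & Hy & _). eauto.
Qed.

Lemma partner_total (K X : Type) (s : K -> rel X) (p q x : X) :
  code s p = code s q -> conn s p x -> exists y, partner s p q x y.
Proof.
  intros E [u Hu]. destruct (code_reach _ _ s u p q x E Hu) as [y Hy].
  exists y, u. auto.
Qed.

Lemma partner_fun (K X : Type) (s : K -> rel X) (p q x y z : X) :
  (forall k b x y z, step (s k) b x y -> step (s k) b x z -> y = z) ->
  code s p = code s q -> partner s p q x y -> partner s p q x z -> y = z.
Proof.
  intros Hs E (u & H1 & H2) (v & H3 & H4).
  (* The pair [(u, v)] in the code records that both words lead to the same point, also from [q]. *)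
  assert (Hc : code s p (u, v)) by (exists x; auto).
  rewrite E in Hc. destruct Hc as (t & H5 & H6). simpl in *.
  transitivity t.
  - eapply reach_fun; eauto.
  - symmetry. eapply reach_fun; eauto.
Qed.

Lemma partner_step (K X : Type) (s : K -> rel X) (p q x y x' y' : X) (k : K) :
  (forall k b x y z, step (s k) b x y -> step (s k) b x z -> y = z) ->
  code s p = code s q -> partner s p q x y -> partner s p q x' y' ->
  s k x x' -> s k y y'.
Proof.
  intros Hs E (u & H1 & H2) Hxy' Hk.
  (* The step becomes one more letter of the word, which is then followed from [q]. *)
  assert (H3 : reach s (u ++ [(k, true)]) p x').
  { apply reach_app. exists x. split; auto. exists x'. split; [exact Hk | reflexivity]. }
  destruct (code_reach _ _ s _ p q x' E H3) as [y2 H4].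
  assert (y2 = y') by (eapply partner_fun; eauto; eexists; eauto). subst y2.
  apply reach_app in H4. destruct H4 as (y1 & H4 & y2 & H5 & H6). simpl in *. subst y2.
  assert (y1 = y) by (eapply reach_fun; eauto). subst y1. exact H5.
Qed.

(** Codes are subsets of a countable set, so there are at most continuum many. *)
Lemma lt_card_codes (K X : Type) :
  le_card K nat -> lt_card (nat -> bool) X ->
  lt_card (list (K * bool) * list (K * bool) -> Prop) X.
Proof.
  intros HK [H1 H2].
  assert (Hw : le_card (list (K * bool) * list (K * bool)) nat).
  { eapply le_card_trans; [|apply le_card_nat_prod_nat].
    apply le_card_prod; apply le_card_signed_words; auto. }
  destruct Hw as [c Hc].
  assert (H : le_card (list (K * bool) * list (K * bool) -> Prop) (nat -> bool)).
  { apply (le_card_rel _ _ (fun P f => forall p, P p <-> f (c p) = true)).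
    - intros P.
      exists (fun n => if excluded_middle_informative (exists p, c p = n /\ P p)
                       then true else false).
      intros p. destruct (excluded_middle_informative _) as [H|H]; split; auto.
      + intros _. destruct H as (p' & E & Hp). apply Hc in E. congruence.
      + intros Hp. elim H. eauto.
      + discriminate.
    - intros P Q f HP HQ. apply functional_extensionality. intros p.
      apply propositional_extensionality. rewrite HP, HQ. tauto. }
  split; [eapply le_card_trans; eauto|].
  intros H3. apply H2. eapply le_card_trans; eauto.
Qed.

(** * Adding copies of an orbit *)

(* [Y]-many copies of the orbit of [x0] next to the part [R] of [X]. *)
Definition copies {K X : Type} (Y : Type) (s : K -> rel X) (x0 : X) (R : X -> Prop) : Type :=
  ((Y * {t | conn s x0 t}) + {x | R x})%type.

Definition on_copies {K X : Type} (Y : Type) (s : K -> rel X) (x0 : X) (R : X -> Prop)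
    (f : rel X) : rel (copies Y s x0 R) :=
  fun m m' => match m, m' with
  | inl (y, t), inl (y', t') => y = y' /\ f (proj1_sig t) (proj1_sig t')
  | inr x, inr x' => f (proj1_sig x) (proj1_sig x')
  | _, _ => False
  end.

Arguments on_copies {K X} Y s x0 R f !m !m'.

Lemma step_on_copies (K X Y : Type) (s : K -> rel X) (x0 : X) (R : X -> Prop)
    (f : rel X) (b : bool) (m m' : copies Y s x0 R) :
  step (on_copies Y s x0 R f) b m m' <-> on_copies Y s x0 R (step f b) m m'.
Proof.
  destruct b, m as [[y t]|x], m' as [[y' t']|x']; simpl; try tauto.
  split; intros [-> H]; auto.
Qed.

(** Paths lift to a copy letter by letter, as they never leave the orbit. Hence an invariant set
    contains a copy entirely or misses it. *)
Lemma conn_on_copies (K X Y : Type) (s : K -> rel X) (x0 : X) (R : X -> Prop)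
    (y : Y) (t t' : {t | conn s x0 t}) :
  conn (fun k => on_copies Y s x0 R (s k)) (inl (y, t)) (inl (y, t')).
Proof.
  assert (H : forall u (t t' : {t | conn s x0 t}),
    reach s u (proj1_sig t) (proj1_sig t') ->
    conn (fun k => on_copies Y s x0 R (s k)) (inl (y, t)) (inl (y, t'))).
  { induction u as [|[k b] u IH]; intros t1 t2 Hu; simpl in Hu.
    - apply sig_eq in Hu. subst t2. apply conn_refl.
    - destruct Hu as (z & H1 & H2).
      assert (Hz : conn s x0 z).
      { eapply conn_trans; [apply (proj2_sig t1) | eapply conn_step; eauto]. }
      apply (conn_trans _ _ _ _ (inl (y, exist _ z Hz))).
      + apply (conn_step _ _ _ k b). apply step_on_copies. simpl. auto.
      + apply IH. exact H2. }
  assert (Htt' : conn s (proj1_sig t) (proj1_sig t')).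
  { eapply conn_trans; [apply conn_sym, (proj2_sig t) | apply (proj2_sig t')]. }
  destruct Htt' as [u Hu]. eauto.
Qed.

(** Either deficiencies are unrestricted, or the copied orbit has none and all missing points lie in
    the part [R], where they were missing already. *)
Lemma in_I_on_copies (K X Y A : Type) (s : K -> rel X) (x0 : X) (R : X -> Prop) (k : K) :
  in_I X A (s k) ->
  invariant R (s k) ->
  le_card (copies Y s x0 R) A \/
    (forall b t, conn s x0 t -> exists t', step (s k) b t t') ->
  in_I (copies Y s x0 R) A (on_copies Y s x0 R (s k)).
Proof.
  intros Hs HR HA. apply in_I_step in Hs. destruct Hs as [Hs Hc].
  apply in_I_step. split.
  - intros b m m1 m2 H1 H2. apply step_on_copies in H1, H2.
    destruct m as [[y t]|x], m1 as [[y1 t1]|x1], m2 as [[y2 t2]|x2]; simpl in *; try tauto.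
    + destruct H1 as [<- H1], H2 as [<- H2]. do 2 f_equal. apply sig_eq. eauto.
    + f_equal. apply sig_eq. eauto.
  - intros b. destruct HA as [HA|HA].
    + eapply le_card_trans; [apply le_card_sig | exact HA].
    + eapply le_card_trans; [|apply (Hc b)].
      apply (le_card_rel _ _ (fun m x => exists H, proj1_sig m = inr (exist R (proj1_sig x) H))).
      * intros [[[y t]|[x Hx]] Hm]; simpl.
        -- elim Hm. destruct (HA b (proj1_sig t) (proj2_sig t)) as [t' Ht'].
           assert (Hc' : conn s x0 t').
           { eapply conn_trans; [apply (proj2_sig t) | eapply conn_step; eauto]. }
           exists (inl (y, exist _ t' Hc')). apply step_on_copies. simpl. auto.
        -- assert (Hx' : ~ exists z, step (s k) b x z).
           { intros [z Hz]. apply Hm.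
             assert (Hz' : R z) by (destruct b; apply HR in Hz; apply Hz; auto).
             exists (inr (exist _ z Hz')). apply step_on_copies. exact Hz. }
           exists (exist _ x Hx'), Hx. reflexivity.
      * intros m1 m2 x [H1 E1] [H2 E2]. apply sig_eq.
        refine (eq_trans E1 (eq_trans _ (eq_sym E2))). f_equal. apply sig_eq. reflexivity.
Qed.

(** * From a set to a smaller one *)

Lemma universal_I_pull (X Z A Sig : Type) (h : X -> Z) (w : nat -> word Sig)
    (s : nat -> rel Z) (phi : Sig -> rel Z) :
  (forall x y, h x = h y -> x = y) ->
  (forall a, invariant (image h) (phi a)) ->
  (forall a, in_I Z A (phi a)) ->
  (forall n, eval_word phi (w n) = s n) ->
  exists psi : Sig -> rel X, (forall a, in_I X A (psi a)) /\
    forall n, eval_word psi (w n) = pull h (s n).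
Proof.
  intros Hh Hinv HI Hev. exists (fun a => pull h (phi a)). split.
  - intros a. apply in_I_pull; auto.
  - intros n. rewrite eval_word_pull; auto. rewrite Hev. auto.
Qed.

(** Regularity is applied to the partition of [X] by codes, which has fewer than [|X|] classes. *)
Lemma exists_abundant_code (K X : Type) (s : K -> rel X) :
  le_card K nat -> lt_card (nat -> bool) X -> regular_card X ->
  exists x0, le_card X {x | code s x = code s x0}.
Proof.
  intros HK HX [Hnat Hreg].
  destruct (classic (exists c, le_card X {x | code s x = c})) as [[c Hc]|Hn].
  - destruct Hnat as [i _]. destruct Hc as [f Hf].
    destruct (f (i 0)) as [x0 Hx0]. exists x0. rewrite Hx0. exists f. auto.
  - elim (Hreg _ (fun c x => code s x = c) (lt_card_codes K X HK HX)); eauto.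
    intros c. split; [apply le_card_sig | eauto].
Qed.

(* The deficiencies reached along one word from the points sharing the code of [x0]
   are distinct, and there are too many of them. *)
Lemma abundant_orbit_full (K X A : Type) (s : K -> rel X) (x0 : X) (k : K) (b : bool) (t : X) :
  (forall k, in_I X A (s k)) -> lt_card A X ->
  le_card X {x | code s x = code s x0} ->
  conn s x0 t -> exists t', step (s k) b t t'.
Proof.
  intros Hs [_ HAX] HX [u Hu]. apply NNPP. intros Hn. apply HAX.
  assert (Hfun : forall k b x y z, step (s k) b x y -> step (s k) b x z -> y = z).
  { intros k'. apply (proj1 (proj1 (in_I_step _ _ _) (Hs k'))). }
  destruct (proj1 (in_I_step _ _ _) (Hs k)) as [_ Hc].
  eapply le_card_trans; [exact HX|]. eapply le_card_trans; [|apply (Hc b)].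
  apply (le_card_rel _ _ (fun d y => reach s u (proj1_sig d) (proj1_sig y))).
  - intros [d Hd]. simpl. destruct (code_reach _ _ s u x0 d t (eq_sym Hd) Hu) as [y Hy].
    assert (Hy' : ~ exists z, step (s k) b y z).
    { intros [z Hz]. apply Hn.
      assert (Hr : reach s (u ++ [(k, b)]) d z).
      { apply reach_app. exists y. split; auto. exists z. split; [auto | reflexivity]. }
      destruct (code_reach _ _ s _ d x0 z Hd Hr) as [t' Ht'].
      apply reach_app in Ht'. destruct Ht' as (t1 & H1 & t2 & H2 & _).
      rewrite (reach_fun _ _ s u x0 t t1 Hfun Hu H1). eauto. }
    exists (exist _ y Hy'). exact Hy.
  - intros d1 d2 y H1 H2. apply sig_eq. eapply reach_inj; eauto.
Qed.

Lemma universal_I_smaller (X Y A Sig : Type) (w : nat -> word Sig) :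
  lt_card (nat -> bool) X -> lt_card X Y -> regular_card X ->
  (lt_card A X \/ le_card Y A) -> le_card Sig nat ->
  universal_I Y A w -> universal_I X A w.
Proof.
  intros H2X [HXY HYX] Hreg HA HSig Huniv s Hs.
  assert (Hfun : forall k b x y z, step (s k) b x y -> step (s k) b x z -> y = z).
  { intros k. apply (proj1 (proj1 (in_I_step _ _ _) (Hs k))). }
  assert (HX : le_card nat X) by apply Hreg.
  assert (HY : le_card nat Y) by (eapply le_card_trans; eauto).
  destruct (exists_abundant_code nat X s (le_card_refl _) H2X Hreg) as [x0 HD].
  pose (D := fun x => code s x = code s x0).
  destruct (orbit_representatives nat X s D) as (r & Hr & Hrc & HrD).
  assert (Hrr : forall x, r (r x) = r x) by auto.
  (* By the choice of [r], these are the points whose orbit misses [D]. All other orbits are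
     isomorphic to that of [x0]. *)
  pose (R := fun x => ~ D (r x)).
  assert (Hsr : forall k x y, s k x y -> r x = r y).
  { intros k x y H. apply Hrc. apply (conn_step _ _ s k true). exact H. }
  assert (HR : forall k, invariant R (s k)).
  { intros k x y H. unfold R. rewrite (Hsr k x y H). tauto. }
  pose (Z := copies Y s x0 R).
  pose (sZ := fun k => on_copies Y s x0 R (s k)).
  (* The base point of the orbit; [inl (y, t0)] will mark the copy with index [y]. *)
  pose (t0 := exist (conn s x0) x0 (conn_refl _ _ s x0)).
  assert (HT : le_card {t | conn s x0 t} nat).
  { eapply le_card_trans.
    - apply (le_card_orbits _ _ s _ (fun x => x = x0)); auto using le_card_refl.
      intros x Hx. exists x0. auto.
    - eapply le_card_trans; [|apply le_card_nat_prod_nat].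
      apply le_card_prod; [|apply le_card_refl].
      exists (fun _ => 0). intros [x ->] [y ->] _. apply sig_eq. auto. }
  assert (HZY : le_card Z Y).
  { apply le_card_sum; auto.
    - eapply le_card_trans; [|apply le_card_prod_nat; exact HY].
      apply le_card_prod; auto using le_card_refl.
    - eapply le_card_trans; [apply le_card_sig | exact HXY]. }
  assert (HYZ : eq_card Y Z).
  { apply cantor_bernstein; auto. exists (fun y => inl (y, t0)). congruence. }
  destruct (universal_I_eq_card Y Z A Sig w HYZ Huniv sZ) as (phi & Hphi & Hev).
  { intros k. apply in_I_on_copies; auto. destruct HA as [HA|HA].
    - right. intros b t. apply (abundant_orbit_full nat X A); auto.
    - left. eapply le_card_trans; eauto. }
  assert (Hphif : forall k b x y z, step (phi k) b x y -> step (phi k) b x z -> y = z).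
  { intros a. apply (proj1 (proj1 (in_I_step _ _ _) (Hphi a))). }
  pose proof HXY as [i Hi].
  (* One base point in each of [|X|] copies, together with all of [R]. Its closure [C] under [phi]
     still has at most [|X|] points, because the alphabet is countable. *)
  pose (C0 := fun z : Z => (exists x, z = inl (i x, t0)) \/ exists x, z = inr x).
  pose (C := fun z => exists z0, C0 z0 /\ conn phi z0 z).
  assert (HC0 : forall z, C0 z -> C z).
  { intros z H. exists z. split; auto. apply conn_refl. }
  assert (HCphi : forall a, invariant C (phi a)).
  { intros a x y H. split; intros (z & H1 & H2); exists z; split; auto;
      apply (invariant_conn _ _ phi z a) in H; tauto. }
  (* The relations [sZ k] are values of words in [phi], so they inherit the invariance of [C]. *)
  assert (HCconn : forall x y, conn sZ x y -> C x -> C y).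
  { assert (HCs : forall k, invariant C (sZ k)).
    { intros k. replace (sZ k) with (eval_word phi (w k)).
      - apply eval_word_invariant. auto.
      - apply rel_ext, Hev. }
    intros x y [u Hu]. revert x Hu. induction u as [|[k b] u IH]; intros x; simpl.
    - congruence.
    - intros (x' & H1 & H2) Hx. apply (IH x'); auto.
      destruct b; apply HCs in H1; tauto. }
  assert (HCt : forall y t t', C (inl (y, t)) -> C (inl (y, t'))).
  { intros y t t'. apply HCconn, conn_on_copies. }
  assert (HCX : le_card {z | C z} X).
  { eapply le_card_trans.
    - apply (le_card_orbits _ _ phi _ C0); auto.
    - eapply le_card_trans; [|apply le_card_prod_nat; exact HX].
      apply le_card_prod; [|apply le_card_refl].
      apply (le_card_trans _ (X + {x | R x})).
      + apply (le_card_rel _ _ (fun z x => proj1_sig z = match x with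
          inl x => inl (i x, t0) | inr x => inr x end)).
        * intros [z [[x ->]|[x ->]]]; simpl; [exists (inl x) | exists (inr x)]; auto.
        * intros z1 z2 x E1 E2. apply sig_eq. exact (eq_trans E1 (eq_sym E2)).
      + apply le_card_sum; auto using le_card_refl, le_card_sig. }
  (* [Q] indexes the orbits of [X] isomorphic to that of [x0], and [Q'] those in [C]. *)
  pose (Q := {q | D q /\ r q = q}). pose (Q' := {y | C (inl (y, t0))}).
  assert (HXQ : le_card X Q).
  { apply le_card_of_prod_nat.
    - intros H. apply (proj2 H2X). eapply le_card_trans; [exact H|].
      exists Nat.eqb. intros n m E. apply PeanoNat.Nat.eqb_eq. rewrite E.
      apply PeanoNat.Nat.eqb_refl.
    - eapply le_card_trans; [exact HD|].
      apply (le_card_orbits _ _ s); auto using le_card_refl.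
      intros x Hx. exists (r x). split; auto. split; auto.
      apply (HrD x); auto. apply conn_refl. }
  (* Both have size [|X|]: [Q'] contains the indices put into [C0] and embeds into [C]. *)
  assert (HQQ' : eq_card Q Q').
  { apply cantor_bernstein.
    - apply (le_card_trans _ X); [apply le_card_sig|].
      assert (H : forall x, C (inl (i x, t0))) by (intros x; apply HC0; left; eauto).
      exists (fun x => exist (fun y => C (inl (y, t0))) (i x) (H x)).
      intros x y E. injection E as E. auto.
    - eapply le_card_trans; [|exact HXQ]. eapply le_card_trans; [|exact HCX].
      exists (fun q : Q' => exist C _ (proj2_sig q)).
      intros x y E. injection E as E. apply sig_eq. auto. }
  destruct HQQ' as (j & k & Hkj & Hjk).
  (* The graph of an isomorphism from [X] onto [C]. Points of [R] stay fixed; any other orbit goes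
     to the copy that [j] assigns to its representative, with the representative sent to the base
     point. *)
  pose (H := fun (x : X) (z : Z) => match z with
    | inl (y, t) => exists q : Q, proj1_sig q = r x /\ y = proj1_sig (j q) /\
                                  partner s (r x) x0 x (proj1_sig t)
    | inr x' => x = proj1_sig x'
    end).
  assert (Htot : forall x, exists z, H x z).
  { intros x. destruct (classic (R x)) as [Hx|Hx].
    - exists (inr (exist R x Hx)). reflexivity.
    - apply NNPP in Hx.
      destruct (partner_total nat X s (r x) x0 x Hx (Hr x)) as [t Ht].
      assert (Ht' : conn s x0 t) by (destruct Ht as (u & _ & Hu); exists u; auto).
      pose (q := exist (fun q => D q /\ r q = q) (r x) (conj Hx (Hrr x))).
      exists (inl (proj1_sig (j q), exist _ t Ht')). exists q. auto. }
  destruct (choice _ _ _ Htot) as [h Hh].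
  assert (Hfunc : forall x z, H x z -> z = h x).
  { intros x z Hz. specialize (Hh x). destruct z as [[y t]|x1], (h x) as [[y' t']|x2].
    - destruct Hz as (q & E1 & -> & Ht), Hh as (q' & E2 & -> & Ht').
      assert (q = q') by (apply sig_eq; congruence). subst q'. do 2 f_equal.
      apply sig_eq. apply (partner_fun nat X s (r x) x0 x); auto.
      rewrite <- E1. apply (proj2_sig q).
    - destruct Hz as ([q [Hq Hrq]] & E1 & _), x2 as [x2 Hx2]. simpl in *.
      elim Hx2. rewrite <- Hh, <- E1. exact Hq.
    - destruct Hh as ([q [Hq Hrq]] & E1 & _), x1 as [x1 Hx1]. simpl in *.
      elim Hx1. rewrite <- Hz, <- E1. exact Hq.
    - f_equal. apply sig_eq. simpl in *. congruence. }
  assert (Hinj : forall x x', h x = h x' -> x = x').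
  { intros x x' E. pose proof (Hh x) as H1. pose proof (Hh x') as H2. rewrite <- E in H2.
    destruct (h x) as [[y t]|z].
    - destruct H1 as (q & E1 & -> & H1), H2 as (q' & E2 & E3 & H2).
      apply sig_eq in E3. assert (q = q') by congruence. subst q'.
      rewrite <- E1 in H1. rewrite <- E2 in H2. apply partner_sym in H1, H2.
      apply (partner_fun nat X s x0 (proj1_sig q) (proj1_sig t)); auto.
      symmetry. apply (proj2_sig q).
    - simpl in *. congruence. }
  assert (Him : forall z, image h z <-> C z).
  { intros z. split.
    - intros [x ->]. specialize (Hh x). destruct (h x) as [[y t]|x'].
      + destruct Hh as (q & _ & -> & _). apply (HCt _ t0). apply (proj2_sig (j q)).
      + apply HC0. right. eauto.
    - intros Hz. enough (E : exists x, H x z) by (destruct E as [x E]; exists x; auto).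
      destruct z as [[y t]|x'].
      + assert (Hy : C (inl (y, t0))) by (apply (HCt y t); auto).
        pose (q := k (exist _ y Hy)).
        destruct (partner_total nat X s x0 (proj1_sig q) (proj1_sig t)) as [x Hx].
        * symmetry. apply (proj2_sig q).
        * apply (proj2_sig t).
        * assert (E : r x = proj1_sig q).
          { rewrite <- (proj2 (proj2_sig q)). symmetry. apply Hrc.
            destruct Hx as (u & _ & Hu). exists u. auto. }
          exists x, q. split; auto. split.
          -- unfold q. rewrite Hjk. reflexivity.
          -- rewrite E. apply partner_sym. exact Hx.
      + exists (proj1_sig x'). reflexivity. }
  destruct (universal_I_pull X Z A Sig h w sZ phi) as (psi & Hpsi & Hevpsi); auto.
  - intros a x y Hxy. rewrite !Him. apply (HCphi a). exact Hxy.
  - intros n. apply rel_ext, Hev.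
  (* It remains to see that [h] carries [s] to [sZ]. The mixed cases cannot occur, since [s]
     preserves representatives and hence [R]. *)
  - exists psi. split; auto. intros n. rewrite Hevpsi. intros x x'. unfold pull, sZ.
    pose proof (Hh x) as H1. pose proof (Hh x') as H2.
    destruct (h x) as [[y t]|z], (h x') as [[y' t']|z']; simpl.
    + destruct H1 as (q & E1 & -> & H1), H2 as (q' & E2 & -> & H2).
      assert (Hq : code s (proj1_sig q) = code s x0) by apply (proj2_sig q).
      rewrite <- E1 in H1. rewrite <- E2 in H2. split.
      * intros [E Hst]. apply sig_eq in E. assert (q = q') by congruence. subst q'.
        apply partner_sym in H1, H2. apply (partner_step nat X s _ _ _ _ _ _ n Hfun (eq_sym Hq) H1 H2 Hst).
      * intros Hst. assert (q = q').
        { apply sig_eq. rewrite E1, E2. eauto. }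
        subst q'. split; auto. eapply partner_step; eauto.
    + split; [tauto|]. intros Hst. simpl in H2. subst x'. apply Hsr in Hst.
      destruct H1 as ([q [Hq Hrq]] & E1 & _). simpl in E1. elim (proj2_sig z').
      rewrite <- Hst, <- E1. exact Hq.
    + split; [tauto|]. intros Hst. simpl in H1. subst x. apply Hsr in Hst.
      destruct H2 as ([q [Hq Hrq]] & E1 & _). simpl in E1. elim (proj2_sig z).
      rewrite Hst, <- E1. exact Hq.
    + simpl in H1, H2. subst. tauto.
Qed.

Theorem theorem2p1 (X Y A : Type) (hA : zero_or_infinite A) :
  (le_card nat X -> lt_card X Y -> ((A -> False) \/ eq_card A Y) ->
     forall (Sig : Type) (w : nat -> word Sig), countable Sig ->
       universal_I X A w -> universal_I Y A w) /\
  (lt_card (nat -> bool) X -> lt_card X Y -> regular_card X ->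
     (lt_card A X \/ le_card Y A) ->
     forall (Sig : Type) (w : nat -> word Sig), countable Sig ->
       universal_I Y A w -> universal_I X A w).
Proof.
  split.
  - intros HX HXY HA Sig w _. apply universal_I_larger; auto.
    destruct HA as [HA|(f & g & _ & Hfg)]; auto.
    right. exists g. intros x y E. rewrite <- (Hfg x), <- (Hfg y). congruence.
  - intros H2X HXY Hreg HA Sig w HSig. apply universal_I_smaller; auto.
Qed.
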